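(* Let $u\in\mathbb{R}^n$ have all entries positive, $\alpha_u>0$, $x\in\mathbb{R}^n$ with $x\ge0$ and $\alpha_u\ge u^Tx$, and let $X$ be a symmetric $n\times n$ matrix. The valid inequality $X\preceq\alpha_u\,\mathrm{diag}(u)^{-1}\mathrm{diag}(x)$ is dominated by the RLT constraints generated by $x\ge0$ and $\alpha_u\ge u^Tx$; that is, if $(x,X)$ satisfies $$\alpha_ux_i\ge u^TX_{\cdot i}\quad(i=1,\dots,n)\qquad\text{and}\qquad X_{ij}\ge0\quad(1\le i<j\le n),$$ then $$X\preceq\alpha_u\,\mathrm{diag}(u)^{-1}\mathrm{diag}(x).$$
   Context: $\mathrm{diag}(v)$ is the diagonal matrix with diagonal $v$; $X_{\cdot i}$ is the $i$-th column of $X$; $A\preceq B$ means $B-A$ is positive semidefinite. The RLT constraint generated by two linear inequalities $f(x)\ge0$, $g(x)\ge0$ is obtained by expanding $f(x)g(x)\ge0$ and replacing $xx^T$ by $X$ (it is imposed for pairs of distinct constraints); the pairs $x_i\ge0,x_j\ge0$ give $X_{ij}\ge0$ and the pairs $x_i\ge0$, $\alpha_u-u^Tx\ge0$ give $\alpha_ux_i\ge u^TX_{\cdot i}$. A constraint is dominated by a set of constraints if it is implied by them. *)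

(* Defs.v *)
From mathcomp Require Import all_boot all_order all_algebra.
From mathcomp Require Import reals.

Set Implicit Arguments.
Unset Strict Implicit.
Unset Printing Implicit Defensive.

Import Order.TTheory GRing.Theory Num.Theory.
Local Open Scope ring_scope.

Definition psdmx (R : numDomainType) (n : nat) (A : 'M[R]_n) : Prop :=
  A^T = A /\ forall v : 'cV[R]_n, 0 <= (v^T *m A *m v) 0 0.

Definition loewner_le (R : numDomainType) (n : nat) (A B : 'M[R]_n) : Prop :=
  psdmx (B - A).

(* [diag_mx] expects a row vector. *)
Definition diagc (R : pzSemiRingType) (n : nat) (v : 'cV[R]_n) : 'M[R]_n :=
  diag_mx v^T.

(* Main.v *)
Require Import Defs.
From mathcomp Require Import all_boot all_order all_algebra.
From mathcomp Require Import reals.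
From mathcomp Require Import ring.

(** Put [w i = v i / u i] and [A i j = u i * u j * X i j].  The constraints
    [u^T X_(.i) <= alpha_u * x i] bound each diagonal entry of
    [alpha_u diag(u)^-1 diag(x)] below by a weighted column sum of [X], so the
    quadratic form of the difference at [v] is at least
    [\sum_i \sum_j A i j * (w i ^+ 2 - w i * w j)].  This is the quadratic form
    at [w] of the Laplacian of the graph with edge weights [A]; symmetry of [A]
    makes it equal to half of [\sum_i \sum_j A i j * (w i - w j) ^+ 2]
    ([laplacian_form_double]).  The diagonal of [A], whose sign is unknown,
    contributes nothing to that sum, and off the diagonal [A] is nonnegative
    ([laplacian_form_ge0]). *)

Set Implicit Arguments.
Unset Strict Implicit.
Unset Printing Implicit Defensive.

Import Order.TTheory GRing.Theory Num.Theory.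
Local Open Scope ring_scope.

(** Averaging the form with its copy in which [i] and [j] are exchanged
    completes the squares. *)
Lemma laplacian_form_double (R : comPzRingType) (n : nat)
    (A : 'I_n -> 'I_n -> R) (w : 'I_n -> R) :
    (forall i j, A i j = A j i) ->
  (\sum_i \sum_j A i j * (w i ^+ 2 - w i * w j)) *+ 2 =
    \sum_i \sum_j A i j * (w i - w j) ^+ 2.
Proof.
move=> A_sym; rewrite mulr2n {2}exchange_big /= -big_split /=.
apply: eq_bigr => i _; rewrite -big_split /=.
by apply: eq_bigr => j _; rewrite (A_sym j i); ring.
Qed.

Lemma laplacian_form_ge0 (R : realDomainType) (n : nat)
    (A : 'I_n -> 'I_n -> R) (w : 'I_n -> R) :
    (forall i j, A i j = A j i) -> (forall i j, i != j -> 0 <= A i j) ->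
  0 <= \sum_i \sum_j A i j * (w i ^+ 2 - w i * w j).
Proof.
move=> A_sym A_ge0; rewrite -(pmulrn_lge0 _ (ltn0Sn 1)).
rewrite laplacian_form_double //.
apply: sumr_ge0 => i _; apply: sumr_ge0 => j _.
have [->|neq_ij] := eqVneq i j; first by rewrite subrr expr0n mulr0.
by rewrite mulr_ge0 ?sqr_ge0 ?A_ge0.
Qed.

Lemma quadratic_formE (R : comPzRingType) (n : nat) (M : 'M[R]_n)
    (v : 'cV[R]_n) :
  (v^T *m M *m v) 0 0 = \sum_i \sum_j M i j * (v i 0 * v j 0).
Proof.
rewrite mxE exchange_big; apply: eq_bigr => j _.
rewrite mxE mulr_suml; apply: eq_bigr => i _.
by rewrite mxE; ring.
Qed.

Lemma invmx_diagc (R : fieldType) (n : nat) (u : 'cV[R]_n) :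
    (forall i, u i 0 != 0) ->
  invmx (diagc u) = diagc (\col_i (u i 0)^-1).
Proof.
move=> u_neq0; set V := RHS.
have uV : diagc u *m V = 1%:M.
  rewrite /V /diagc mulmx_diag -diag_const_mx; congr diag_mx.
  by apply/rowP=> i; rewrite !mxE mulfV.
have [u_unit _] := mulmx1_unit uV.
by rewrite -[LHS]mulmx1 -uV mulKmx.
Qed.

Theorem theorem3p1 (R : realType) (n : nat) (u : 'cV[R]_n) (alpha_u : R)
    (x : 'cV[R]_n) (X : 'M[R]_n)
    (u_gt0 : forall i : 'I_n, 0 < u i 0)
    (alpha_u_gt0 : 0 < alpha_u)
    (x_ge0 : forall i : 'I_n, 0 <= x i 0)
    (ux_le : (u^T *m x) 0 0 <= alpha_u)
    (X_sym : X^T = X)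
    (rlt_ux : forall i : 'I_n, (u^T *m col i X) 0 0 <= alpha_u * x i 0)
    (rlt_xx : forall i j : 'I_n, (i < j)%N -> 0 <= X i j) :
  loewner_le X (alpha_u *: (invmx (diagc u) *m diagc x)).
Proof.
have u_neq0 i : u i 0 != 0 by rewrite gt_eqF.
have XC i j : X i j = X j i by rewrite -{1}X_sym mxE.
have X_ge0 i j : i != j -> 0 <= X i j.
  by rewrite neq_ltn => /orP[/rlt_xx //|/rlt_xx]; rewrite XC.
pose d : 'rV[R]_n := \row_i (alpha_u * x i 0 / u i 0).
have -> : alpha_u *: (invmx (diagc u) *m diagc x) = diag_mx d.
  rewrite invmx_diagc // /diagc mulmx_diag -linearZ /=; congr diag_mx.
  by apply/rowP=> i; rewrite !mxE; ring.
split=> [|v]; first by rewrite linearB /= tr_diag_mx X_sym.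
pose w i := v i 0 / u i 0.
pose A i j := u i 0 * u j 0 * X i j.
have form_ge0 : 0 <= \sum_i \sum_j A i j * (w i ^+ 2 - w i * w j).
  apply: laplacian_form_ge0 => [i j|i j /X_ge0 Xij_ge0].
    by rewrite /A XC; ring.
  by rewrite /A !mulr_ge0 // ltW.
apply: le_trans form_ge0 _; rewrite quadratic_formE.
apply: ler_sum => i _.
(* The slack between the two forms splits by rows: row [i] contributes
   [(alpha_u * x i - u^T X_(.i)) * v i ^+ 2 / u i]. *)
have -> : \sum_j A i j * (w i ^+ 2 - w i * w j) =
    (u^T *m col i X) 0 0 * (v i 0 ^+ 2 / u i 0)
    - \sum_j X i j * (v i 0 * v j 0).
  rewrite mxE mulr_suml -sumrB; apply: eq_bigr => j _.
  rewrite !mxE (XC j i) /A /w; field.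
  by rewrite !u_neq0.
have -> : \sum_j (diag_mx d - X) i j * (v i 0 * v j 0) =
    alpha_u * x i 0 * (v i 0 ^+ 2 / u i 0)
    - \sum_j X i j * (v i 0 * v j 0).
  under eq_bigr do rewrite !mxE mulrBl.
  rewrite sumrB; congr (_ - _).
  rewrite (bigD1 i) //= big1 => [|j neq_ji].
    by rewrite eqxx mulr1n addr0; field.
  by rewrite eq_sym (negPf neq_ji) mulr0n mul0r.
by rewrite lerD2r ler_wpM2r ?rlt_ux // divr_ge0 ?sqr_ge0 // ltW.
Qed.
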